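(* Let $n\in\mathbb N$, let $W_1,\dots,W_n\in\mathcal O_{\widetilde{\mathcal W}}$ be simple nontrivial $\widetilde{\mathcal W}$-modules, let $V\in\mathcal O_{\mathcal L}$ be a simple $\mathcal L$-module, and let $\lambda_1,\dots,\lambda_n\in\mathbb C^*$ be pairwise distinct. Then the $\mathcal L$-module $V\otimes W_1[\lambda_1]\otimes W_2[\lambda_2]\otimes\cdots\otimes W_n[\lambda_n]$ is simple.
   Context: $\mathcal{L}$ has basis $\{d_n=t^{n+1}\frac{d}{dt},I_n=t^n,z_1,z_2,z_3\mid n\in\mathbb{Z}\}$ with brackets $[d_n,d_m]=(m-n)d_{m+n}+\delta_{n,-m}\frac{n^3-n}{12}z_1$, $[d_n,I_m]=mI_{m+n}+\delta_{n,-m}(n^2+n)z_2$, $[I_n,I_m]=n\delta_{n,-m}z_3$, $z_i$ central, graded by $\deg d_i=\deg I_i=i$, $\deg z_j=0$. $\widetilde{\mathcal W}=\mathbb C[t]\frac{d}{dt}+\mathbb C[t]$ (spanned by $d_i$, $i\ge-1$, $I_i$, $i\ge0$). For $L=\mathcal L$ or $\widetilde{\mathcal W}$, $\mathcal O_L$ is the category of $L$-modules in which every vector is annihilated by all homogeneous elements of sufficiently large degree. A module in $\mathcal O_{\widetilde{\mathcal W}}$ is naturally a module over $\mathbb C[[t]]\frac{d}{dt}+\mathbb C[[t]]$. For $\lambda\in\mathbb C^*$ and $W\in\mathcal O_{\widetilde{\mathcal W}}$, $W[\lambda]$ is the $\mathcal L$-module on the space $W$ with $z_i\circ w=0$, $(f(t)\frac{d}{dt})\circ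 w=(f(t+\lambda)\frac{d}{dt})w$, $f(t)\circ w=f(t+\lambda)w$ for $f\in\mathbb C[t,t^{-1}]$, where $(t+\lambda)^m=\sum_{i\ge0}\binom{m}{i}\lambda^{m-i}t^i\in\mathbb C[[t]]$. *)

(* Defs.v *)
(* Complex numbers are  R[i]  for  R : realType
   (mathcomp-real-closed's complex numbers over a Dedekind-complete
   real field, i.e. genuinely C). *)
From HB Require Import structures.
From mathcomp Require Import all_boot all_order all_algebra.
From mathcomp Require Import reals complex.
From Stdlib Require Import ClassicalEpsilon.

Set Implicit Arguments.
Unset Strict Implicit.
Unset Printing Implicit Defensive.

Import Order.TTheory GRing.Theory Num.Theory.
Local Open Scope ring_scope.

Section Defs.
Variable C : fieldType.

Definition islin (U V : lmodType C) (f : U -> V) : Prop :=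
  forall (a : C) (x y : U), f (a *: x + y) = a *: f x + f y.

Definition subspace (U : lmodType C) (S : U -> Prop) : Prop :=
  S 0 /\ (forall (a : C) x y, S x -> S y -> S (a *: x + y)).

(* Modules over the Lie algebra  L  with basis d_n, I_n (n : int), z1,z2,z3 *)
(* A representation is given by the operators by which the basis elements *)
(* act; it is an L-module iff these are linear and the commutators of the *)
(* operators realise the brackets of L.                                     *)

Definition delta (n m : int) : C := if n == - m then 1 else 0.

Definition is_Lmod (V : lmodType C) (d I : int -> V -> V) (z1 z2 z3 : V -> V)
  : Prop :=
  [/\ (forall n, islin (d n)), (forall n, islin (I n)),
      islin z1, islin z2 & islin z3] /\
  [/\
      (forall n m v, d n (d m v) - d m (d n v) =
          (m - n)%:~R *: d (m + n) v
          + (delta n m * ((n ^+ 3 - n)%:~R / 12%:R)) *: z1 v),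
      (forall n m v, d n (I m v) - I m (d n v) =
          m%:~R *: I (m + n) v + (delta n m * (n ^+ 2 + n)%:~R) *: z2 v),
      (forall n m v, I n (I m v) - I m (I n v) =
          (n%:~R * delta n m) *: z3 v) &
      (forall z, z = z1 \/ z = z2 \/ z = z3 ->
         [/\ forall n v, z (d n v) = d n (z v),
             forall n v, z (I n v) = I n (z v),
             forall v, z (z1 v) = z1 (z v),
             forall v, z (z2 v) = z2 (z v) &
             forall v, z (z3 v) = z3 (z v)])].

(* category O_L: each vector is killed by all homogeneous elements of
   sufficiently large degree (of degree N > 0 these are spanned by d_N, I_N) *)
Definition in_O_L (V : lmodType C) (d I : int -> V -> V) : Prop :=
  forall v : V, exists N : int, forall i : int, N <= i -> d i v = 0 /\ I i v = 0.

Definition Lsubmodule (V : lmodType C) (d I : int -> V -> V) (z1 z2 z3 : V -> V)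
  (S : V -> Prop) : Prop :=
  subspace S /\
  [/\ forall n v, S v -> S (d n v), forall n v, S v -> S (I n v),
      forall v, S v -> S (z1 v), forall v, S v -> S (z2 v)
    & forall v, S v -> S (z3 v)].

Definition simple_L (V : lmodType C) (d I : int -> V -> V) (z1 z2 z3 : V -> V)
  : Prop :=
  (exists v : V, v != 0) /\
  forall S, Lsubmodule d I z1 z2 z3 S ->
    (exists v, S v /\ v != 0) -> forall v, S v.

(* Modules over  W~ = C[t] d/dt + C[t], spanned by d_i (i >= -1), I_i (i >= 0)
   (all central terms of L vanish on this subalgebra).  The operators wd i
   for i < -1 and wI i for i < 0 are irrelevant (not part of the data). *)

Record Wmod := MkWmod {
  wcar : lmodType C;
  wd : int -> wcar -> wcar;   (* action of d_i = t^{i+1} d/dt, i >= -1 *)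
  wI : int -> wcar -> wcar    (* action of I_i = t^i, i >= 0 *)
}.
Arguments wd : clear implicits.
Arguments wI : clear implicits.

Definition is_Wmod (W : Wmod) : Prop :=
  [/\ (forall n, -1 <= n -> islin (wd W n)),
      (forall n, 0 <= n -> islin (wI W n)),
      (forall n m w, -1 <= n -> -1 <= m ->
          wd W n (wd W m w) - wd W m (wd W n w) = (m - n)%:~R *: wd W (m + n) w),
      (forall n m w, -1 <= n -> 0 <= m ->
          wd W n (wI W m w) - wI W m (wd W n w) = m%:~R *: wI W (m + n) w) &
      (forall n m w, 0 <= n -> 0 <= m ->
          wI W n (wI W m w) = wI W m (wI W n w))].

Definition in_O_W (W : Wmod) : Prop :=
  forall w : wcar W, exists N : int,
    forall i : int, N <= i -> wd W i w = 0 /\ wI W i w = 0.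

Definition Wsubmodule (W : Wmod) (S : wcar W -> Prop) : Prop :=
  subspace S /\
  (forall n w, -1 <= n -> S w -> S (wd W n w)) /\
  (forall n w, 0 <= n -> S w -> S (wI W n w)).

Definition simple_W (W : Wmod) : Prop :=
  (exists w : wcar W, w != 0) /\
  forall S, @Wsubmodule W S -> (exists w, S w /\ w != 0) -> forall w, S w.

Definition nontrivial_W (W : Wmod) : Prop :=
  exists w : wcar W,
    (exists n, -1 <= n /\ wd W n w != 0) \/ (exists n, 0 <= n /\ wI W n w != 0).

Definition gbinom (m : int) (i : nat) : C :=
  (\prod_(k < i) (m - k%:Z)%:~R) / (i`!)%:R.

(* sum of an eventually-zero sequence  sum_{i >= 0} f i  (a finite sum);
   the number of terms is chosen (by Hilbert's epsilon) beyond which f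
   vanishes; the value does not depend on that choice. *)
Definition fsum (U : lmodType C) (f : nat -> U) : U :=
  let N := epsilon (inhabits 0%N) (fun N => forall j, (N <= j)%N -> f j = 0) in
  \sum_(i < N) f i.

(* (f(t) d/dt) o w = (f(t+lambda) d/dt) w  for f = t^{m+1}:
   (t+lambda)^{m+1} d/dt = sum_i binom(m+1,i) lambda^{m+1-i} t^i d/dt
                         = sum_i binom(m+1,i) lambda^{m+1-i} d_{i-1}   *)
Definition tw_d (lam : C) (W : Wmod) (m : int) (w : wcar W) : wcar W :=
  fsum (fun i : nat =>
    (gbinom (m + 1) i * lam ^ (m + 1 - i%:Z)) *: wd W (i%:Z - 1) w).

(* f(t) o w = f(t+lambda) w  for f = t^m:  sum_i binom(m,i) lambda^{m-i} I_i *)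
Definition tw_I (lam : C) (W : Wmod) (m : int) (w : wcar W) : wcar W :=
  fsum (fun i : nat =>
    (gbinom m i * lam ^ (m - i%:Z)) *: wI W i%:Z w).
(* z_i act by 0 on W[lambda]. *)

Definition multilin (V : lmodType C) (n : nat) (Wc : 'I_n -> lmodType C)
  (U : lmodType C) (f : V -> (forall i, Wc i) -> U) : Prop :=
  (forall w, islin (fun v => f v w)) /\
  (forall v w (i : 'I_n), islin (fun x : Wc i => f v (dfwith w x))).

Definition is_tensor_product (V : lmodType C) (n : nat) (Wc : 'I_n -> lmodType C)
  (T : lmodType C) (mu : V -> (forall i, Wc i) -> T) : Prop :=
  multilin mu /\
  forall (U : lmodType C) (f : V -> (forall i, Wc i) -> U), multilin f ->
    (exists g : T -> U, islin g /\ forall v w, g (mu v w) = f v w) /\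
    (forall g1 g2 : T -> U, islin g1 -> islin g2 ->
       (forall v w, g1 (mu v w) = g2 (mu v w)) -> forall t, g1 t = g2 t).

End Defs.

Arguments tw_d {C} lam W m w.
Arguments tw_I {C} lam W m w.
Arguments is_tensor_product {C} V n Wc T mu.
Arguments multilin {C} V n Wc U f.

(* Main.v *)
(* Applied in large degree to a fixed tensor, L moves only the factors
   W_k[lambda_k], a polynomial acting on W_k through its Taylor expansion at
   lambda_k.  By the Chinese remainder theorem a subspace S stable under L is
   therefore stable under each copy of W~ acting on its own factor alone, and
   then also under L acting on V alone.  By Dixmier's form of Schur's lemma
   (countably generated modules over an uncountable algebraically closed field)
   the endomorphisms of W_k are scalars, so a nonzero S contains a nonzero pure
   tensor, obtained by making the factors constant one after the other; the
   simplicity of V and of the W_k then yields all pure tensors. *)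
Require Import Defs.
From HB Require Import structures.
From mathcomp Require Import all_boot all_order all_algebra.
From mathcomp Require Import boolp classical_sets reals complex.
From mathcomp Require Import ring lra zify.
Import Order.TTheory GRing.Theory Num.Theory.
Set Implicit Arguments.
Unset Strict Implicit.
Unset Printing Implicit Defensive.
Local Open Scope ring_scope.

(** * Linear maps, subspaces and uncountability *)

Section Linear.
Variable C : fieldType.

Section Maps.
Variables (U V : lmodType C) (f : U -> V).
Hypothesis fL : islin f.

Lemma islin0 : f 0 = 0.
Proof. by have := fL (-1) 0 0; rewrite scaler0 addr0 scaleN1r addNr. Qed.

Lemma islinD x y : f (x + y) = f x + f y.
Proof. by have := fL 1 x y; rewrite !scale1r. Qed.

Lemma islinZ a x : f (a *: x) = a *: f x.
Proof. by have := fL a x 0; rewrite islin0 !addr0. Qed.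

Lemma islinN x : f (- x) = - f x.
Proof. by rewrite -scaleN1r islinZ scaleN1r. Qed.

Lemma islinB x y : f (x - y) = f x - f y.
Proof. by rewrite islinD islinN. Qed.

Lemma islin_sum I (r : seq I) (P : pred I) (F : I -> U) :
  f (\sum_(i <- r | P i) F i) = \sum_(i <- r | P i) f (F i).
Proof.
by elim/big_rec2: _ => [|i y1 y2 _ <-]; rewrite ?islin0 // islinD.
Qed.

End Maps.

Section Subspaces.
Variables (U : lmodType C) (S : U -> Prop).
Hypothesis SS : subspace S.

Lemma subspace0 : S 0. Proof. by case: SS. Qed.

Lemma subspaceZ a x : S x -> S (a *: x).
Proof.
by case: SS => S0 SL Sx; have := SL a x 0 Sx S0; rewrite addr0.
Qed.

Lemma subspaceD x y : S x -> S y -> S (x + y).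
Proof. by case: SS => S0 SL Sx Sy; have := SL 1 x y Sx Sy; rewrite scale1r. Qed.

Lemma subspaceB x y : S x -> S y -> S (x - y).
Proof. by move=> Sx Sy; rewrite -scaleN1r addrC; case: SS => _; apply. Qed.

Lemma subspace_sum I (r : seq I) (P : pred I) (F : I -> U) :
  (forall i, P i -> S (F i)) -> S (\sum_(i <- r | P i) F i).
Proof.
move=> SF; elim/big_rec: _ => [|i x Pi Sx]; first exact: subspace0.
by apply: subspaceD => //; apply: SF.
Qed.

End Subspaces.

End Linear.

Lemma infinite_uniq_seq (T : eqType) (P : T -> Prop) :
  (forall s : seq T, exists x, P x /\ x \notin s) ->
  forall n, exists s : seq T, [/\ uniq s, size s = n & forall x, x \in s -> P x].
Proof.
move=> Pinf; elim=> [|n [s [us ss sP]]]; first by exists [::].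
have [x [Px xs]] := Pinf s.
exists (x :: s); split => /=; [by rewrite xs | by rewrite ss |].
by move=> y; rewrite inE => /predU1P [->|/sP].
Qed.

(** Stated with finite lists instead of single values, so that it directly refutes a covering by
    countably many finite sets. *)
Definition uncountable_type (T : eqType) : Prop :=
  forall f : nat -> seq T, exists x, forall n, x \notin f n.

(** Otherwise each [P n] would have at most [n] elements, and listing these for every [n] would
    exhaust [T]. It serves to find [n.+1] vectors in a span of [n] vectors. *)
Lemma uncountable_pigeonhole (T : eqType) (P : nat -> T -> Prop) :
  uncountable_type T -> (forall x, exists n, P n x) ->
  exists n (a : 'I_n.+1 -> T), injective a /\ forall i, P n (a i).
Proof.
move=> unc Pcov; apply: contrapT => noN.
have fin n : exists s : seq T, forall x, P n x -> x \in s.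
  apply: contrapT => nofin; apply: noN.
  have [|s [us ss sP]] := @infinite_uniq_seq T (P n) _ n.+1.
    move=> s; apply: contrapT => nox; apply: nofin; exists s => x Px.
    by apply: contrapT => /negP xs; apply: nox; exists x.
  case: s us ss sP => // x0 s us ss sP.
  exists n, (fun i => nth x0 (x0 :: s) i); split=> [i j /eqP|i]; last first.
    by apply: sP; rewrite mem_nth // ss.
  by rewrite nth_uniq ?ss // => /eqP /val_inj.
have [f fP] := choice fin.
have [x xf] := unc f.
have [n /fP] := Pcov x.
by rewrite (negbTE (xf n)).
Qed.

Lemma real_uncountable_seq (R : realType) (f : nat -> R) :
  exists x, forall n, f n <> x.
Proof.
(* Cantor's nested intervals: the new closed interval misses [y]. It is the right half if [y] lies
   left of the midpoint, otherwise the left third, which ends strictly before the midpoint. *)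
pose step y (p : R * R) : R * R :=
  if y < (p.1 + p.2) / 2 then ((p.1 + p.2) / 2, p.2)
  else (p.1, p.1 + (p.2 - p.1) / 3).
pose J := fix J n : R * R := if n is m.+1 then step (f m) (J m) else (0, 1).
have Jlt n : (J n).1 < (J n).2.
  elim: n => [|n IH] /=; first exact: ltr01.
  by rewrite /step; case: ifP => _ /=; lra.
have Jstep n : (J n).1 <= (J n.+1).1 /\ (J n.+1).2 <= (J n).2.
  by have := Jlt n; rewrite /= /step; case: ifP => _ /= ?; split; lra.
have Jmono n k : (J n).1 <= (J (n + k)%N).1 /\ (J (n + k)%N).2 <= (J n).2.
  elim: k => [|k [IH1 IH2]]; first by rewrite addn0.
  rewrite addnS; have [? ?] := Jstep (n + k)%N.
  by split; [apply: le_trans IH1 _|apply: le_trans IH2].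
have Jcross m n : (J m).1 <= (J n).2.
  have [h1 _] := Jmono m n; have [_ h2] := Jmono n m.
  rewrite addnC in h2; apply: le_trans h1 _; apply: le_trans h2.
  exact/ltW/Jlt.
pose E := [set x | exists n, x = (J n).1]%classic.
have E0 : E (J 0%N).1 by exists 0%N.
have Eub n : ubound E (J n).2 by move=> _ [m ->].
have hsE : has_sup E by split; [exists (J 0%N).1 | exists (J 0%N).2].
exists (sup E) => n fn.
have h1 : (J n.+1).1 <= sup E by apply: (ub_le_sup hsE.2); exists n.+1.
have h2 : sup E <= (J n.+1).2 by apply: ge_sup => //; exists (J 0%N).1.
move: h1 h2; rewrite -fn /= /step; case: ifP => /= fm; have := Jlt n.
  by move=> _; rewrite leNgt fm.
by move: fm; case: ltP => //; set a := (J n).1; set b := (J n).2 => *; lra.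
Qed.

Lemma complex_uncountable (R : realType) : uncountable_type R[i].
Proof.
move=> f.
(* All lists are flattened into one sequence of real parts; a real number outside it, seen as a
   complex number, lies in none of the lists. *)
pose g k : R :=
  if unpickle k is Some (n, i) then complex.Re (nth 0 (f n) i) else 0.
have [x xg] := real_uncountable_seq g.
exists (x%:C)%C => n; apply/negP => /(nthP 0) [i _ xi].
by apply: (xg (pickle (n, i))); rewrite /g pickleK xi.
Qed.

(** * Schur's lemma in countable dimension *)

Section CountableModules.
Variables (C : numClosedFieldType) (W : lmodType C).

Section PolynomialsInEndomorphism.
Variable phi : W -> W.
Hypothesis phiL : islin phi.
Implicit Types (p q : {poly C}) (w : W).

Definition poly_act (p : {poly C}) (w : W) : W :=
  \sum_(i < size p) p`_i *: iter i phi w.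

Lemma iter_islin i : islin (iter i phi).
Proof. by elim: i => [|i IH] a x y //=; rewrite IH phiL. Qed.

Lemma poly_act_widen n p w :
  (size p <= n)%N -> poly_act p w = \sum_(i < n) p`_i *: iter i phi w.
Proof.
move=> pn; rewrite /poly_act (big_ord_widen n (fun i => p`_i *: iter i phi w)) //.
rewrite big_mkcond /=; apply: eq_bigr => i _; case: ltnP => // pi.
by rewrite nth_default // scale0r.
Qed.

Lemma poly_act_islin p : islin (poly_act p).
Proof.
move=> a x y; rewrite /poly_act scaler_sumr -big_split /=.
by apply: eq_bigr => i _; rewrite iter_islin scalerDr !scalerA mulrC.
Qed.

Lemma poly_actD p q w : poly_act (p + q) w = poly_act p w + poly_act q w.
Proof.
pose n := maxn (size p) (size q).
rewrite (@poly_act_widen n (p + q)) ?size_polyD //.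
rewrite (@poly_act_widen n p) ?leq_maxl // (@poly_act_widen n q) ?leq_maxr //.
by rewrite -big_split /=; apply: eq_bigr => i _; rewrite coefD scalerDl.
Qed.

Lemma poly_actZ a p w : poly_act (a *: p) w = a *: poly_act p w.
Proof.
rewrite (@poly_act_widen (size p) (a *: p)) ?size_scale_leq //.
rewrite /poly_act scaler_sumr.
by apply: eq_bigr => i _; rewrite coefZ scalerA.
Qed.

Lemma poly_act0 w : poly_act 0 w = 0.
Proof. by rewrite /poly_act size_poly0 big_ord0. Qed.

Lemma poly_act1 w : poly_act 1 w = w.
Proof. by rewrite /poly_act size_poly1 big_ord1 coef1 /= scale1r. Qed.

Lemma poly_act_sum I (r : seq I) (F : I -> {poly C}) w :
  poly_act (\sum_(i <- r) F i) w = \sum_(i <- r) poly_act (F i) w.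
Proof. by elim/big_rec2: _ => [|i y1 y2 _ <-]; rewrite ?poly_act0 // poly_actD. Qed.

Lemma poly_actXM p w : poly_act (p * 'X) w = phi (poly_act p w).
Proof.
rewrite (@poly_act_widen (size p).+1); last first.
  by rewrite (leq_trans (size_polyMleq _ _)) // size_polyX addn2.
rewrite big_ord_recl coefMX eqxx scale0r add0r /poly_act (islin_sum phiL).
by apply: eq_bigr => i _; rewrite coefMX /= (islinZ phiL).
Qed.

Lemma poly_act_XsubCM a p w :
  poly_act (p * ('X - a%:P)) w = phi (poly_act p w) - a *: poly_act p w.
Proof.
have -> : p * ('X - a%:P) = p * 'X + (- a) *: p.
  by rewrite mulrBr -mul_polyC polyCN mulNr mulrC (mulrC p).
by rewrite poly_actD poly_actXM poly_actZ scaleNr.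
Qed.

Lemma poly_act_comm p w : poly_act p (phi w) = phi (poly_act p w).
Proof.
rewrite /poly_act (islin_sum phiL); apply: eq_bigr => i _.
by rewrite (islinZ phiL) -iterSr.
Qed.

(** Over an algebraically closed field [p] splits, so its action is a nonzero scalar times a product
    of maps [phi - a], each injective for want of eigenvectors. *)
Lemma poly_act_inj p w : p != 0 ->
  (forall a x, phi x = a *: x -> x = 0) -> poly_act p w = 0 -> w = 0.
Proof.
move=> p0 noeig; have [r pE] := closed_field_poly_normal p.
rewrite pE poly_actZ => /eqP; rewrite scaler_eq0 lead_coef_eq0 (negbTE p0) /=.
move=> {pE} /eqP; elim: r => [|a r IH]; first by rewrite big_nil poly_act1.
rewrite big_cons mulrC poly_act_XsubCM => /eqP; rewrite subr_eq0 => /eqP.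
by move=> /noeig /IH.
Qed.

End PolynomialsInEndomorphism.

(** The zero space qualifies as well; nonzero vectors are obtained separately where needed. *)
Definition simple_family (J : Type) (A : J -> W -> W) : Prop :=
  forall S : W -> Prop, subspace S -> (forall j w, S w -> S (A j w)) ->
    (exists w, S w /\ w != 0) -> forall w, S w.

Definition span_seq (e : nat -> W) (n : nat) (w : W) : Prop :=
  exists a : 'I_n -> C, w = \sum_(i < n) a i *: e i.

(** The coefficient matrix has [n.+1] rows and rank at most [n], so a nonzero row of its left kernel
    gives the relation. *)
Lemma span_seq_dependent (e : nat -> W) n (u : 'I_n.+1 -> W) :
  (forall k, span_seq e n (u k)) ->
  exists c : 'I_n.+1 -> C, (exists k, c k != 0) /\ \sum_k c k *: u k = 0.
Proof.
move=> uS; have [a aP] := boolp.choice uS.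
pose M := \matrix_(k < n.+1, i < n) a k i.
have : kermx M != 0.
  by rewrite -mxrank_eq0 mxrank_ker -lt0n subn_gt0 ltnS rank_leq_col.
move=> /matrix0Pn [k0 [k ker0]].
exists (fun k => kermx M k0 k); split; first by exists k.
under eq_bigr => j _ do rewrite aP scaler_sumr.
rewrite exchange_big /= big1 // => i _.
under eq_bigr => j _ do rewrite scalerA.
rewrite -scaler_suml.
have -> : \sum_j kermx M k0 j * a j i = (kermx M *m M) k0 i.
  by rewrite mxE; apply: eq_bigr => j _; rewrite [M j i]mxE.
by rewrite mulmx_ker mxE scale0r.
Qed.

Lemma span_seq_subspace (e : nat -> W) : subspace (fun w => exists n, span_seq e n w).
Proof.
split=> [|c x y [m [a ->]] [n [b ->]]].
  by exists 0%N, (fun=> 0); rewrite big_ord0.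
(* Coefficients are padded with zeros so that both combinations have a common length. *)
pose ext p (f : 'I_p -> C) i : C := if insub i is Some j then f j else 0.
have extE p q (f : 'I_p -> C) : (p <= q)%N ->
    \sum_(i < p) f i *: e i = \sum_(i < q) ext p f i *: e i.
  move=> pq.
  have -> : \sum_(i < p) f i *: e i = \sum_(i < p) ext p f i *: e i.
    apply: eq_bigr => i _; rewrite /ext insubT //= => lt_i.
    by congr (f _ *: _); apply: val_inj.
  rewrite (big_ord_widen q (fun i => ext p f i *: e i)) // big_mkcond /=.
  apply: eq_bigr => i _; case: ifP => // pi.
  by rewrite /ext insubF // scale0r.
exists (maxn m n), (fun i => c * ext m a i + ext n b i).
rewrite (extE _ _ a (leq_maxl m n)) (extE _ _ b (leq_maxr m n)).
rewrite scaler_sumr -big_split /=; apply: eq_bigr => i _.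
by rewrite scalerDl scalerA.
Qed.

Variables (J : countType) (A : J -> W -> W).
Hypothesis AL : forall j, islin (A j).
Hypothesis Asimple : simple_family A.

(** The words in the operators, applied to one nonzero vector, are countably many, and their span is
    stable, hence everything. *)
Lemma simple_family_countable_span :
  exists e : nat -> W, forall w, exists n, span_seq e n w.
Proof.
have [W0|nW0] := pselect (forall w : W, w = 0).
  by exists (fun=> 0) => w; exists 0%N, (fun=> 0); rewrite big_ord0.
have [w0 w0P] : exists w0 : W, w0 != 0.
  apply: contrapT => nw; apply: nW0 => w; apply: contrapT => /eqP ww.
  by apply: nw; exists w.
pose word := foldr A w0.
pose e i := if unpickle i is Some s then word s else 0.
have SS := span_seq_subspace e.
have eS i : exists n, span_seq e n (e i).
  exists i.+1, (fun k => (k == ord_max)%:R).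
  rewrite (bigD1 ord_max) //= eqxx scale1r big1 ?addr0 // => k /negbTE ->.
  by rewrite scale0r.
exists e; apply: Asimple => //; last first.
  exists w0; split=> //; have <- : e (pickle (@nil J)) = w0 by rewrite /e pickleK.
  exact: eS.
move=> j w [n [a ->]]; rewrite (islin_sum (AL j)).
apply: (subspace_sum SS) => i _; rewrite (islinZ (AL j)); apply: (subspaceZ SS).
rewrite {2}/e; case: unpickle => [s|]; last first.
  by rewrite (islin0 (AL j)); apply: subspace0 SS.
have -> : A j (word s) = e (pickle (j :: s)) by rewrite /e pickleK.
exact: eS.
Qed.

(* Dixmier's form of Schur's lemma: without an eigenvalue the vectors
   (phi - a)^-1 w0, for a in C, would be linearly independent. *)
Lemma schur_uncountable (phi : W -> W) :
  uncountable_type C -> islin phi -> (forall j w, phi (A j w) = A j (phi w)) ->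
  exists c, forall w, phi w = c *: w.
Proof.
move=> unc phiL phiA; apply: contrapT => noc.
have psiL a : islin (fun w => phi w - a *: w).
  move=> b x y; rewrite phiL scalerBr !scalerDr !scalerA (mulrC b) !opprD.
  by rewrite addrACA.
have psiA a j w : phi (A j w) - a *: A j w = A j (phi w - a *: w).
  by rewrite phiA (islinB (AL j)) (islinZ (AL j)).
have [w0 w0P] : exists w0 : W, w0 != 0.
  apply: contrapT => nw; apply: noc; exists 0 => w; rewrite scale0r.
  apply: contrapT => /eqP ww; apply: nw; by exists (phi w).
have noeig a x : phi x = a *: x -> x = 0.
  move=> xa; apply: contrapT => /eqP x0; apply: noc; exists a.
  apply: (@Asimple (fun w => phi w = a *: w)); last by exists x.
    split=> [|b y z ya za]; first by rewrite (islin0 phiL) scaler0.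
    by rewrite phiL ya za scalerDr !scalerA mulrC.
  by move=> j w ww; rewrite phiA ww (islinZ (AL j)).
(* The image of [phi - a] is stable, and nonzero because [w0] is not an eigenvector. *)
have surj a : exists u, phi u - a *: u = w0.
  apply: (@Asimple (fun w => exists u, phi u - a *: u = w)).
  - split=> [|b _ _ [u <-] [v <-]]; first by exists 0; exact: (islin0 (psiL a)).
    by exists (b *: u + v); apply: psiL.
  - by move=> j _ [u <-]; exists (A j u); rewrite psiA.
  exists (phi w0 - a *: w0); split; first by exists w0.
  by rewrite subr_eq0; apply: contraNneq w0P => /noeig ->.
have [u uP] := boolp.choice surj.
have [e eP] := simple_family_countable_span.
have [n [a [a_inj aP]]] := uncountable_pigeonhole unc (fun x => eP (u x)).
have [c [[k ck] c0]] := @span_seq_dependent e n (u \o a) aP.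
(* The product of all [phi - a i] is applied to the relation between the [u (a j)]. Since
   [phi - a j] sends [u (a j)] to [w0], the polynomial with terms [c j *: Q j] annihilates [w0]. *)
pose Q j := \prod_(i < n.+1 | i != j) ('X - (a i)%:P).
have QE j : \prod_(i < n.+1) ('X - (a i)%:P) = Q j * ('X - (a j)%:P).
  by rewrite (bigD1 j) //= mulrC.
have := congr1 (poly_act phi (\prod_(i < n.+1) ('X - (a i)%:P))) c0.
have pL := poly_act_islin phiL.
rewrite (islin0 (pL _)) (islin_sum (pL _)).
rewrite (eq_bigr (fun j => poly_act phi (c j *: Q j) w0)) => [|j _]; last first.
  rewrite (islinZ (pL _)) poly_actZ /= (QE j) poly_act_XsubCM //.
  by rewrite -poly_act_comm // -(islinZ (pL _)) -(islinB (pL _)) uP.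
rewrite -poly_act_sum => w00; move/eqP: w0P; apply.
apply: (poly_act_inj phiL _ noeig w00).
(* As in Lagrange interpolation, only the term of [k] survives at [a k], so this polynomial is
   nonzero. *)
apply/eqP => /(congr1 (fun p => p.[a k])); rewrite horner0 horner_sum.
rewrite (bigD1 k) //= [X in _ + X]big1 => [|j jk]; last first.
  rewrite hornerZ /Q (bigD1 k) 1?eq_sym //= hornerM hornerXsubC subrr.
  by rewrite mul0r mulr0.
apply/eqP; rewrite addr0 hornerZ mulf_eq0 (negbTE ck) /= /Q horner_prod.
apply/prodf_neq0 => j jk; rewrite hornerXsubC subr_eq0 eq_sym.
by apply: contra jk => /eqP /a_inj ->.
Qed.

End CountableModules.

(** * Sums of images of equivariant maps *)

Section Isotypic.
Variables (C : numClosedFieldType) (W T : lmodType C) (J : countType).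
Variables (A : J -> W -> W) (B : J -> T -> T).
Hypothesis unc : uncountable_type C.
Hypothesis AL : forall j, islin (A j).
Hypothesis BL : forall j, islin (B j).
Hypothesis Asimple : simple_family A.

Definition equivariant (f : W -> T) : Prop :=
  islin f /\ forall j w, f (A j w) = B j (f w).

(** The recursive form lets inductions split off one map at a time. *)
Fixpoint sum_of_images (fs : seq (W -> T)) (t : T) : Prop :=
  if fs is f :: fs' then exists x, sum_of_images fs' (t - f x) else t = 0.

Fixpoint lin_comb_of (fs : seq (W -> T)) (s : W -> T) : Prop :=
  if fs is f :: fs' then exists c, lin_comb_of fs' (fun w => s w - c *: f w)
  else forall w, s w = 0.

Lemma lin_comb_of_cons f fs s : lin_comb_of fs s -> lin_comb_of (f :: fs) s.
Proof.
move=> sP; exists 0; congr lin_comb_of: sP; apply: funext => w.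
by rewrite scale0r subr0.
Qed.

Definition all_equivariant (fs : seq (W -> T)) : Prop :=
  forall f, List.In f fs -> equivariant f.

Lemma all_equivariant_cons f fs :
  all_equivariant (f :: fs) -> equivariant f /\ all_equivariant fs.
Proof. by move=> fsE; split=> [|g gfs]; apply: fsE; [left|right]. Qed.

Lemma lin_comb_sum_of_images fs s w :
  all_equivariant fs -> lin_comb_of fs s -> sum_of_images fs (s w).
Proof.
elim: fs s => [|f fs IH] s; first by move=> _ /(_ w).
move=> /all_equivariant_cons [[fL _] fsE] [c /(IH _ fsE) sP].
by exists (c *: w); rewrite (islinZ fL).
Qed.

Lemma sum_of_images_subspace fs :
  all_equivariant fs -> subspace (sum_of_images fs).
Proof.
elim: fs => [_|f fs IH /all_equivariant_cons [[fL fA] /IH SS]].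
  by split=> //= a x y -> ->; rewrite scaler0 addr0.
split=> [|a s t [x sx] [y ty]].
  by exists 0; rewrite (islin0 fL) subr0; exact: subspace0 SS.
exists (a *: x + y); rewrite fL opprD addrACA -scalerBr.
by case: SS => _; apply.
Qed.

Lemma sum_of_images_stable fs j t :
  all_equivariant fs -> sum_of_images fs t -> sum_of_images fs (B j t).
Proof.
elim: fs t => [t _ ->|f fs IH t /all_equivariant_cons [[fL fA] fsE] [x tx]].
  exact: islin0.
by exists (A j x); rewrite fA -(islinB (BL j)); apply: IH.
Qed.

Lemma equivariant_lcomb c f g :
  equivariant f -> equivariant g -> equivariant (fun w => f w - c *: g w).
Proof.
move=> [fL fA] [gL gA]; split=> [a x y|j w].
  rewrite fL gL scalerDr !scalerA scalerBr scalerA (mulrC c) opprD.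
  by rewrite addrACA.
by rewrite fA gA (islinB (BL j)) (islinZ (BL j)).
Qed.

Lemma equivariant_inj f y : equivariant f -> f y = 0 -> y != 0 -> forall w, f w = 0.
Proof.
move=> [fL fA] fy y0; apply: Asimple; last by exists y.
  split=> [|a u v fu fv]; first exact: islin0.
  by rewrite fL fu fv scaler0 addr0.
by move=> j w fw; rewrite fA fw; apply: islin0.
Qed.

(* If f meets the sum of the other images trivially, the component of s
   along f is an endomorphism of W, hence a scalar by Schur's lemma. *)
Lemma equivariant_lin_comb fs s y :
  all_equivariant fs -> equivariant s -> y != 0 -> sum_of_images fs (s y) ->
  lin_comb_of fs s.
Proof.
elim: fs s y => [|f fs IH] s y.
  by move=> _ sE y0 sy; apply: equivariant_inj sy y0.
move=> /all_equivariant_cons [fE fsE] sE y0 [x sx].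
have SS := sum_of_images_subspace fsE.
have [[z [z0 fz]]|nz] := pselect (exists z, z != 0 /\ sum_of_images fs (f z)).
  have fP := lin_comb_sum_of_images x fsE (IH _ _ fsE fE z0 fz).
  apply/lin_comb_of_cons/(IH _ _ fsE sE y0).
  by rewrite -(subrK (f x) (s y)); apply: subspaceD.
have fI z : sum_of_images fs (f z) -> z = 0.
  by move=> fz; apply: contrapT => /eqP z0; apply: nz; exists z.
have allx w : exists x, sum_of_images fs (s w - f x).
  move: w; apply: Asimple; last by exists y; split=> //; exists x.
    split=> [|a u v [u' uS] [v' vS]].
      exists 0; rewrite (islin0 fE.1) (islin0 sE.1) subr0; exact: subspace0.
    exists (a *: u' + v'); rewrite fE.1 sE.1 opprD addrACA -scalerBr.
    by case: SS => _; apply.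
  move=> j w [w' wS]; exists (A j w'); rewrite fE.2 sE.2 -(islinB (BL j)).
  exact: sum_of_images_stable.
have [phi phiP] := boolp.choice allx.
have uniq_phi w x' : sum_of_images fs (s w - f x') -> phi w = x'.
  move=> x'S; apply/eqP; rewrite -subr_eq0; apply/eqP/fI.
  have := subspaceB SS x'S (phiP w).
  by rewrite opprB addrC addrA subrK (islinB fE.1).
have phiL : islin phi.
  move=> a u v; apply: uniq_phi.
  rewrite fE.1 sE.1 opprD addrACA -scalerBr.
  by case: SS => _; apply; apply: phiP.
have phiA j w : phi (A j w) = A j (phi w).
  apply: uniq_phi; rewrite fE.2 sE.2 -(islinB (BL j)).
  exact: sum_of_images_stable.
have [c cP] := schur_uncountable AL Asimple unc phiL phiA.
exists c; apply: (IH _ _ fsE (equivariant_lcomb c sE fE) y0).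
by rewrite -(islinZ fE.1) -cP; apply: phiP.
Qed.

(** After shortening [fs], [S] meets the sum of the images of the tail only in 0. Then each [f w] is
    congruent, modulo that sum, to a unique element [s w] of [S]; the map [s] is equivariant, and
    [s - f] is a combination of the tail. *)
Lemma lin_comb_in_stable fs (S : T -> Prop) t :
  all_equivariant fs -> subspace S -> (forall j t, S t -> S (B j t)) ->
  S t -> t != 0 -> sum_of_images fs t ->
  exists s, [/\ lin_comb_of fs s, forall w, S (s w) & exists w, s w != 0].
Proof.
move=> fsE SS SB; elim: fs fsE t => [_ t _ /eqP //|f fs IH].
move=> /all_equivariant_cons [fE fsE] t St t0 [x tx].
have NS := sum_of_images_subspace fsE.
have [[t' [St' t'0 t'N]]|nt] :=
    pselect (exists t', [/\ S t', t' != 0 & sum_of_images fs t']).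
  have [s [sP sS s0]] := IH fsE t' St' t'0 t'N.
  by exists s; split=> //; apply: lin_comb_of_cons.
have SN t' : S t' -> sum_of_images fs t' -> t' = 0.
  move=> St' t'N; apply: contrapT => /eqP t'0; apply: nt; by exists t'.
have x0 : x != 0.
  apply: contraNneq t0 => x0; apply/eqP/(SN _ St).
  by move: tx; rewrite x0 (islin0 fE.1) subr0.
have alls w : exists u, S u /\ sum_of_images fs (u - f w).
  move: w; apply: Asimple; last by exists x; split=> //; exists t.
    split=> [|a u v [u' [u'S uS]] [v' [v'S vS]]].
      by exists 0; rewrite (islin0 fE.1) subr0; split; exact: subspace0.
    exists (a *: u' + v'); split; first by case: SS => _; apply.
    by rewrite fE.1 opprD addrACA -scalerBr; case: NS => _; apply.
  move=> j w [w' [w'S wS]]; exists (B j w'); split; first exact: SB.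
  rewrite fE.2 -(islinB (BL j)); exact: sum_of_images_stable.
have [s sP] := boolp.choice alls.
have uniq_s w u : S u -> sum_of_images fs (u - f w) -> s w = u.
  move=> uS uN; have [swS swN] := sP w.
  apply/eqP; rewrite -subr_eq0; apply/eqP/SN; first exact: subspaceB.
  have := subspaceB NS swN uN.
  by rewrite opprB addrA subrK.
have sE : equivariant s.
  split=> [a u v|j w]; apply: uniq_s.
  - by case: SS => _; apply; have [] := sP u; have [] := sP v.
  - rewrite fE.1 opprD addrACA -scalerBr.
    by case: NS => _; apply; have [] := sP u; have [] := sP v.
  - by apply: SB; have [] := sP w.
  - rewrite fE.2 -(islinB (BL j)); apply: sum_of_images_stable => //.
    by have [] := sP w.
have st : s x = t by apply: uniq_s.
exists s; split; [|by move=> w; have [] := sP w|by exists x; rewrite st].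
exists 1; apply: (equivariant_lin_comb fsE (equivariant_lcomb 1 sE fE) x0).
by rewrite scale1r; have [] := sP x.
Qed.

End Isotypic.

(** By Zorn's lemma there is a maximal subspace [H] containing [S] and omitting [v0]. It is a
    complement of the line of [v0], and [f] reads off the coordinate along [v0]. *)
Lemma separating_functional (C : fieldType) (U : lmodType C) (S : U -> Prop) (v0 : U) :
  subspace S -> ~ S v0 ->
  exists f : U -> C^o, [/\ islin f, forall x, S x -> f x = 0 & f v0 = 1].
Proof.
move=> SS nSv0.
pose lclosed (H : set U) := forall a x y, H x -> H y -> H (a *: x + y).
(* the last clause lets the empty union of the empty chain satisfy P *)
pose P (H : set U) :=
  [/\ lclosed H, ~ H v0 & forall x, H x -> forall y, S y -> H y].
have [F FP Ftot|H [[HL Hv0 HS'] Hmax]] := @Zorn_bigcup U P.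
  split=> [a x y [X FX Xx] [Y FY Yy]|[X FX Xv0]|x [X FX Xx] y Sy].
  - have [XL _ _] := FP _ FX; have [YL _ _] := FP _ FY.
    case: (Ftot _ _ FX FY) => XY; first by exists Y => //; apply: YL => //; apply: XY.
    by exists X => //; apply: XL => //; apply: XY.
  - by have [_ /(_ Xv0)] := FP _ FX.
  - by have [_ _ XS] := FP _ FX; exists X => //; apply: XS Xx y Sy.
(* Were [H] empty, [S] itself would be a strictly larger admissible set. *)
have [x0 Hx0] : exists x, H x.
  apply: contrapT => hH; apply: (Hmax S); last by case: SS.
  split=> [x Hx|/(_ _ (subspace0 SS)) H0]; first by case: hH; exists x.
  by apply: hH; exists 0.
have SH := HS' _ Hx0.
have H0 : H 0 := SH _ (subspace0 SS).
have HS : subspace H by split.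
have Hv v : exists a, H (v - a *: v0).
  have [Hv|nHv] := pselect (H v); first by exists 0; rewrite scale0r subr0.
  (* This is the span of [H] and [v]; by maximality of [H] it contains [v0]. *)
  pose B := [set u | exists b, H (u - b *: v)]%classic.
  have [b Hb] : B v0.
    apply: contrapT => nB; apply: (Hmax B).
      split=> [u Hu|BH]; first by exists 0; rewrite scale0r subr0.
      by apply/nHv/BH; exists 1; rewrite scale1r subrr.
    split=> // [a x y [b xb] [c yc]|_ _ y Sy]; last first.
      by exists 0; rewrite scale0r subr0; apply: SH.
    exists (a * b + c).
    by rewrite scalerDl -scalerA opprD addrACA -scalerBr; apply: HL.
  have b0 : b != 0.
    by apply/eqP => b0; apply: Hv0; rewrite b0 scale0r subr0 in Hb.
  exists b^-1; have := subspaceZ HS (- b^-1) Hb.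
  by rewrite scalerBr scalerA mulNr mulVf // !scaleNr scale1r opprK addrC.
have [f fP] := boolp.choice Hv.
have funiq v a : H (v - a *: v0) -> f v = a.
  move=> Ha; apply: contrapT => /eqP; rewrite -subr_eq0 => fa; apply: Hv0.
  have := subspaceZ HS (f v - a)^-1 (subspaceB HS Ha (fP v)).
  have -> : v - a *: v0 - (v - f v *: v0) = (f v - a) *: v0.
    by rewrite scalerBl opprB addrC addrA subrK.
  by rewrite scalerA mulVf // scale1r.
exists f; split=> [a x y|x Sx|]; last by apply: funiq; rewrite scale1r subrr.
by apply: funiq; rewrite scalerDl -scalerA opprD addrACA -scalerBr; apply: HL.
by apply: funiq; rewrite scale0r subr0; apply: SH.
Qed.

(** * Taylor coefficients and interpolation *)

Section TwistPolynomials.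
Variable C : numFieldType.
Implicit Types (p q : {poly C}) (c : C).

Lemma gbinom_nat m i : gbinom C m%:Z i = 'C(m, i)%:R.
Proof.
have -> : gbinom C m%:Z i = (m ^_ i)%:R / i`!%:R.
  rewrite /gbinom; congr (_ / _); elim: i => [|i IH]; first by rewrite big_ord0.
  rewrite big_ord_recr /= IH ffactnSr natrM; case: (leqP i m) => im.
    by rewrite natrB // intrD intrN.
  by rewrite ffact_small // !mul0r.
by rewrite -bin_ffact natrM mulfK // pnatr_eq0 -lt0n fact_gt0.
Qed.

(** The coefficient of $t^i$ in the expansion of $(t+c)^m$ for an integer exponent. *)
Definition twist_coef c (m : int) (i : nat) : C := gbinom C m i * c ^ (m - i%:Z).

Lemma coef_exp_XaddC c m i : (('X + c%:P) ^+ m)`_i = twist_coef c m i.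
Proof.
rewrite addrC exprDn coef_sum /twist_coef gbinom_nat.
have [mi|im] := ltnP m i.
  rewrite bin_small // mul0r big1 // => k _.
  rewrite coefMn -polyC_exp coefCM coefXn eqn_leq [(i <= k)%N]leqNgt.
  by rewrite (leq_trans (ltn_ord k)) //= mulr0 mul0rn.
rewrite (bigD1 (Ordinal (im : (i < m.+1)%N))) //= big1 => [|k ki].
  rewrite coefMn -polyC_exp coefCM coefXn eqxx mulr1 addr0.
  by rewrite (subzn im) -exprnP mulr_natl.
rewrite coefMn -polyC_exp coefCM coefXn; move: ki; rewrite -val_eqE /= eq_sym.
by move/negbTE ->; rewrite mulr0 mul0rn.
Qed.

Lemma coef_comp_XaddC c p i :
  (p \Po ('X + c%:P))`_i = \sum_(j < size p) p`_j * twist_coef c j i.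
Proof.
rewrite comp_polyE coef_sum; apply: eq_bigr => j _.
by rewrite coefZ coef_exp_XaddC.
Qed.

Lemma comp_XsubC_exp c m : (('X - c%:P) ^+ m) \Po ('X + c%:P) = 'X^m.
Proof. by rewrite rmorphXn /= comp_polyB comp_polyX comp_polyC addrK. Qed.

(* Chinese remainder theorem for the pairwise coprime X^N, (X - lam l)^M. *)
Lemma interpolating_polynomial n (lam : 'I_n -> C) N M (k : 'I_n) (i : nat) :
  (forall l, lam l != 0) -> injective lam ->
  exists p, (forall j, (j < N)%N -> p`_j = 0) /\
    forall l a, (a < M)%N ->
      (p \Po ('X + (lam l)%:P))`_a = ((l == k) && (a == i))%:R.
Proof.
move=> lam0 lamI.
pose X l := 'X - (lam l)%:P.
(* [q] carries all the required vanishing. A Bezout multiple of it is congruent to 1 modulo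
   [X k ^+ M], and multiplying by [X k ^+ i] gives the prescribed jet at [lam k]. *)
pose q := 'X^N * \prod_(l < n | l != k) X l ^+ M.
have : coprimep q (X k ^+ M).
  rewrite /q coprimepMl; apply/andP; split.
    apply/coprimep_expl/coprimep_expr; rewrite coprimep_XsubC rootE hornerX.
    exact: lam0.
  rewrite coprimep_sym; elim/big_rec: _ => [|l r lk]; first exact: coprimep1.
  rewrite coprimepMr => ->; rewrite andbT.
  apply/coprimep_expl/coprimep_expr; rewrite coprimep_XsubC root_XsubC.
  by apply: contra lk => /eqP /lamI ->.
have compX l m : (X l ^+ m) \Po ('X + (lam l)%:P) = 'X^m := comp_XsubC_exp _ _.
case/Bezout_eq1_coprimepP => -[u v] /= uv.
exists (q * (u * X k ^+ i)); split=> [j jN|l a aM].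
  by rewrite /q -mulrA coefXnM jN.
have [->|lk] := eqVneq l k; last first.
  rewrite /q (bigD1 l) //= [X in X * _]mulrCA -!mulrA comp_polyM compX.
  by rewrite coefXnM aM.
have -> : q * (u * X k ^+ i) = X k ^+ i - X k ^+ M * (v * X k ^+ i).
  rewrite -[X in X - _]mul1r -uv; ring.
rewrite comp_polyB comp_polyM !compX coefB coefXnM aM subr0 coefXn /=.
by [].
Qed.

End TwistPolynomials.

(** * Tensor products *)

Lemma dfwith_same (I : eqType) (T : I -> Type) (f : forall i, T i) i (x y : T i) :
  dfwith (dfwith f x) y = dfwith f y.
Proof.
by apply: functional_extensionality_dep => j; case: dfwithP => [|k ik];
  rewrite ?dfwith_in // !dfwith_out.
Qed.

Lemma dfwith_id (I : eqType) (T : I -> Type) (f : forall i, T i) i :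
  dfwith f (f i) = f.
Proof. by apply: functional_extensionality_dep => j; case: dfwithP. Qed.

Lemma dfwith_swap (I : eqType) (T : I -> Type) (f : forall i, T i) i j
    (x : T i) (y : T j) : i != j ->
  dfwith (dfwith f x) y = dfwith (dfwith f y) x.
Proof.
move=> ij; apply: functional_extensionality_dep => k.
have [jk|jk] := eqVneq j k.
  by move: y; rewrite jk in ij * => y; rewrite dfwith_in dfwith_out // dfwith_in.
have [ik|ik] := eqVneq i k.
  by move: x; rewrite ik in ij * => x; rewrite dfwith_out // !dfwith_in.
by rewrite !dfwith_out.
Qed.

Section Tensor.
Variables (C : numClosedFieldType) (V : lmodType C) (n : nat).
Variables (Wc : 'I_n -> lmodType C) (T : lmodType C).
Variable mu : V -> (forall k, Wc k) -> T.
Hypothesis muT : is_tensor_product V n Wc T mu.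

Lemma tensor_islin_left w : islin (fun v => mu v w).
Proof. by have [[muL _] _] := muT; apply: muL. Qed.

Lemma tensor_islin_factor v w k : islin (fun x : Wc k => mu v (dfwith w x)).
Proof. by have [[_ muL] _] := muT; apply: muL. Qed.

(** A functional vanishing on [S] but not at [t] would agree with 0 on all pure tensors, against
    uniqueness in the universal property. *)
Lemma tensor_span (S : T -> Prop) :
  subspace S -> (forall v w, S (mu v w)) -> forall t, S t.
Proof.
move=> SS Smu t; apply: contrapT => nSt.
have [f [fL fS ft]] := separating_functional SS nSt.
have cL : islin (fun _ : T => 0 : C^o).
  by move=> a x y; rewrite scaler0 addr0.
have [_ /(_ C^o (fun v w => 0))] := muT.
case=> [|_ /(_ f (fun=> 0) fL cL)].
  by split=> *; move=> a x y; rewrite scaler0 addr0.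
by move=> /(_ (fun v w => fS _ (Smu v w)) t) /eqP; rewrite ft oner_eq0.
Qed.

Lemma tensor_factor_op k (A : Wc k -> Wc k) :
  islin A -> exists B : T -> T, islin B /\
    forall v w, B (mu v w) = mu v (dfwith w (A (w k))).
Proof.
move=> AL; have [_ /(_ T (fun v w => mu v (dfwith w (A (w k)))))] := muT.
case=> [|[B [BL BE]] _]; last by exists B.
split=> [w|v w i]; first exact: tensor_islin_left.
(* In slot [k] the second update overwrites the first; in another slot the two updates commute. *)
have [ik|ik] := eqVneq i k.
  subst i => a x y; rewrite !dfwith_in !dfwith_same AL.
  exact: tensor_islin_factor.
move=> a x y; rewrite !dfwith_out // !(dfwith_swap _ _ _ ik).
exact: tensor_islin_factor.
Qed.

(** Functionals with value 1 on the given factors multiply to a multilinear map with value 1 on this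
    tensor. *)
Lemma tensor_neq0 v w : v != 0 -> (forall k, w k != 0) -> mu v w != 0.
Proof.
move=> v0 w0.
have dual (U : lmodType C) (u : U) : u != 0 ->
    exists f : U -> C^o, islin f /\ f u = 1.
  move=> u0; have S0 : subspace (fun x : U => x = 0).
    by split=> // a x y -> ->; rewrite scaler0 addr0.
  have [|f [fL _ fu]] := separating_functional S0 (v0 := u); first exact/eqP.
  by exists f.
have [f [fL fv]] := dual _ _ v0.
have gP k : exists g : Wc k -> C^o, islin g /\ g (w k) = 1 := dual (Wc k) (w k) (w0 k).
pose g k := projT1 (cid (gP k)).
have gL k : islin (g k) by rewrite /g; case: cid => ? [].
have gw k : g k (w k) = 1 by rewrite /g; case: cid => ? [].
pose F v w : C^o := f v * \prod_(k < n) g k (w k).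
have Fm : multilin V n Wc C^o F.
  split=> [u a x y|u z i a x y].
    by rewrite /F fL mulrDl -scalerAl.
  have FE t : F u (dfwith z t) = f u * (g i t * \prod_(k < n | k != i) g k (z k)).
    rewrite /F (bigD1 i) //= dfwith_in; congr (_ * (_ * _)).
    by apply: eq_bigr => k ki; rewrite dfwith_out // eq_sym.
  by rewrite !FE (gL i) mulrDl mulrDr -scalerAl -scalerAr.
have [_ /(_ _ _ Fm) [[h [hL hF]] _]] := muT.
apply/eqP => mu0; have := hF v w; rewrite mu0 (islin0 hL) /F fv mul1r big1 //.
by move=> /eqP; rewrite eq_sym oner_eq0.
Qed.

End Tensor.

(** * Subspaces stable under each factor separately *)

Section StableSubspaces.
Variables (C : numClosedFieldType) (V : lmodType C) (n : nat).
Variables (Wc : 'I_n -> lmodType C) (T : lmodType C).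
Variable mu : V -> (forall k, Wc k) -> T.
Hypothesis muT : is_tensor_product V n Wc T mu.
Variables (J : countType) (A : forall k, J -> Wc k -> Wc k).
Variable B : 'I_n -> J -> T -> T.
Hypothesis unc : uncountable_type C.
Hypothesis AL : forall k j, islin (A (k := k) j).
Hypothesis Asimple : forall k, simple_family (A (k := k)).
Hypothesis BL : forall k j, islin (B k j).
Hypothesis BE : forall k j v w, B k j (mu v w) = mu v (dfwith w (A j (w k))).
Variable S : T -> Prop.
Hypothesis SS : subspace S.
Hypothesis SB : forall k j t, S t -> S (B k j t).

Definition agree_below (m : nat) (w c : forall k, Wc k) : Prop :=
  forall l : 'I_n, (l < m)%N -> w l = c l.

(** Sums of pure tensors whose first [m] factors from the [Wc] are frozen at those of [c]: all of
    [T] for [m = 0], and the tensors [mu v c] for [m = n]. *)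
Inductive partially_pure (m : nat) (c : forall k, Wc k) : T -> Prop :=
| partially_pure0 : partially_pure m c 0
| partially_pureD v w t : agree_below m w c -> partially_pure m c t ->
    partially_pure m c (mu v w + t).

Lemma partially_pure_subspace m c : subspace (partially_pure m c).
Proof.
split=> [|a x y xP yP]; first exact: partially_pure0.
elim: xP => [|v w t wc _ IH]; first by rewrite scaler0 add0r.
rewrite scalerDr -(islinZ (tensor_islin_left muT w)) -addrA.
exact: partially_pureD.
Qed.

Definition factor_map k (p : V * (forall l, Wc l)) (x : Wc k) : T :=
  mu p.1 (dfwith p.2 x).

Lemma factor_map_equivariant k p : equivariant (A (k := k)) (B k) (factor_map (k := k) p).
Proof.
split=> [|j x]; first exact: tensor_islin_factor.
by rewrite /factor_map BE dfwith_in dfwith_same.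
Qed.

Lemma partially_pure_sum_of_images (k : 'I_n) c t : partially_pure k c t ->
  exists fs, (forall f, List.In f fs ->
      exists2 p, agree_below k p.2 c & f = factor_map (k := k) p)
    /\ sum_of_images fs t.
Proof.
elim=> [|v w u wc _ [fs [fsP us]]]; first by exists [::].
exists (factor_map (k := k) (v, w) :: fs); split=> [f [<-|/fsP //]|].
  by exists (v, w).
by exists (w k); rewrite /factor_map /= dfwith_id addrC addKr.
Qed.

(** Every term of a combination of factor maps, evaluated at [x], has [x] in slot [k]; this is how
    one more slot becomes constant. *)
Lemma lin_comb_partially_pure (k : 'I_n) c fs (s : Wc k -> T) x :
  (forall f, List.In f fs ->
      exists2 p, agree_below k p.2 c & f = factor_map (k := k) p) ->
  lin_comb_of fs s -> partially_pure k.+1 (dfwith c x) (s x).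
Proof.
elim: fs s => [s _ /(_ x) ->|f fs IH s fsP [a sP]]; first exact: partially_pure0.
have [p pc fE] := fsP f (or_introl erefl).
rewrite -(subrKC (a *: f x) (s x)) fE /factor_map.
rewrite -(islinZ (tensor_islin_left muT _)).
apply: partially_pureD.
  move=> l; rewrite ltnS leq_eqVlt => /orP [/eqP /val_inj ->|lk].
    by rewrite !dfwith_in.
  have kl : k != l by rewrite -val_eqE /= gtn_eqF.
  by rewrite !dfwith_out // pc.
have := IH _ (fun g gfs => fsP g (or_intror gfs)) sP.
by rewrite fE /factor_map (islinZ (tensor_islin_left muT _)).
Qed.

Lemma partially_pure_step (k : 'I_n) c t :
  S t -> t != 0 -> partially_pure k c t ->
  exists c' t', [/\ S t', t' != 0 & partially_pure k.+1 c' t'].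
Proof.
move=> St t0 /partially_pure_sum_of_images [fs [fsP tfs]].
have fsE : all_equivariant (A (k := k)) (B k) fs.
  by move=> f /fsP [p _ ->]; apply: factor_map_equivariant.
have [s [sfs sS [x sx]]] :=
  lin_comb_in_stable unc (AL (k := k)) (BL k) (@Asimple k) fsE SS (@SB k) St t0 tfs.
by exists (dfwith c x), (s x); split=> //; apply: lin_comb_partially_pure sfs.
Qed.

Lemma exists_pure : (exists t, S t /\ t != 0) ->
  exists v w, S (mu v w) /\ mu v w != 0.
Proof.
case=> t [St t0].
have H m : (m <= n)%N ->
    exists c t', [/\ S t', t' != 0 & partially_pure m c t'].
  elim: m => [_|m IH mn].
    exists (fun=> 0), t; split=> //; apply: (tensor_span muT) => [|v w].
      exact: partially_pure_subspace.
    by rewrite -[mu v w]addr0; apply: partially_pureD => //; apply: partially_pure0.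
  have [c [t' [St' t'0 t'P]]] := IH (ltnW mn).
  exact: (@partially_pure_step (Ordinal mn) c t').
have [c [t' [St' t'0 t'P]]] := H n (leqnn n).
(* With all slots frozen, the sum collapses by linearity in [V]. *)
suff [v t'E] : exists v, t' = mu v c by exists v, c; rewrite -t'E.
elim: t'P => [|v w u wc _ [v' ->]].
  by exists 0; rewrite (islin0 (tensor_islin_left muT c)).
exists (v + v'); rewrite (islinD (tensor_islin_left muT c)).
by congr (mu _ _ + _); apply: functional_extensionality_dep => l; apply: wc.
Qed.

Lemma stable_subspace_full :
  (forall w, (exists v, S (mu v w) /\ v != 0) -> forall v, S (mu v w)) ->
  (exists t, S t /\ t != 0) -> forall t, S t.
Proof.
move=> SV /exists_pure [v0 [c [Sv0 v00]]].
have Sc v : S (mu v c).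
  apply: SV; exists v0; split=> //; apply: contraNneq v00 => ->.
  by rewrite (islin0 (tensor_islin_left muT c)).
have c0 k : c k != 0.
  apply: contraNneq v00 => ck.
  by rewrite -(dfwith_id c k) ck (islin0 (tensor_islin_factor muT _ _ (k := k))).
apply: (tensor_span muT SS) => v w.
(* Induction on the number of slots freed from [c]; simplicity of [Wc k] frees slot [k]. *)
have H m : (m <= n)%N ->
    forall w, (forall l : 'I_n, (m <= l)%N -> w l = c l) -> S (mu v w).
  elim: m => [_ u uc|m IH mn u uc].
    suff -> : u = c by [].
    by apply: functional_extensionality_dep => l; apply: uc.
  pose k := Ordinal mn; rewrite -(dfwith_id u k).
  apply: (@Asimple k (fun x => S (mu v (dfwith u x)))).
  - split=> [|a x y Sx Sy].
      by rewrite (islin0 (tensor_islin_factor muT _ _ (k := k))); apply: subspace0.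
    by rewrite (tensor_islin_factor muT); case: SS => _; apply.
  - by move=> j x /(SB k j); rewrite BE dfwith_in dfwith_same.
  exists (c k); split=> //; apply: IH; first exact: ltnW.
  move=> l ml; have [<-|kl] := eqVneq k l; first by rewrite dfwith_in.
  rewrite dfwith_out // uc // ltn_neqAle ml andbT.
  by move: kl; rewrite -val_eqE.
by apply: (H n) => // l; rewrite leqNgt ltn_ord.
Qed.

End StableSubspaces.

(** * The twisted action *)

(** The bound chosen by epsilon and [N] both lie beyond the support, so each sum equals the one up
    to their maximum. *)
Lemma fsum_widen (C : fieldType) (U : lmodType C) (f : nat -> U) N :
  (forall j, (N <= j)%N -> f j = 0) -> fsum f = \sum_(i < N) f i.
Proof.
move=> fN; pose P N := forall j, (N <= j)%N -> f j = 0.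
rewrite /fsum -/P; set M := ClassicalEpsilon.epsilon _ _.
have fM : P M by apply: ClassicalEpsilon.epsilon_spec; exists N.
have widen p q : (p <= q)%N -> (forall j, (p <= j)%N -> f j = 0) ->
    \sum_(i < q) f i = \sum_(i < p) f i.
  move=> pq fp; rewrite (big_ord_widen q f pq) [RHS]big_mkcond /=.
  by apply: eq_bigr => i _; case: ltnP => // /fp.
by rewrite -(widen _ _ (leq_maxl M N) fM) (widen _ _ (leq_maxr M N) fN).
Qed.

Section TwistedAction.
Variables (C : numClosedFieldType) (V : lmodType C) (n : nat).
Variables (Wc : 'I_n -> lmodType C) (T : lmodType C).
Variable mu : V -> (forall k, Wc k) -> T.
Hypothesis muT : is_tensor_product V n Wc T mu.
(* Index (true, i) stands for t^i d/dt and (false, i) for t^i. *)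
Variable A : forall k, bool * nat -> Wc k -> Wc k.
Hypothesis A_fin : forall k (w : Wc k), exists N, forall b i,
  (N <= i)%N -> A (b, i) w = 0.
Variables (LV : bool -> int -> V -> V) (LT : bool -> int -> T -> T).
Variable lam : 'I_n -> C.
Hypothesis LV_fin : forall v, exists N : nat, forall b (j : nat),
  (N <= j)%N -> LV b j v = 0.
Hypothesis LTL : forall b j, islin (LT b j).
Hypothesis LTE : forall b j v w, LT b j (mu v w) = mu (LV b j v) w +
  \sum_(k < n) mu v
    (dfwith w (fsum (fun i => twist_coef (lam k) j i *: A (b, i) (w k)))).
Hypothesis lam0 : forall k, lam k != 0.
Hypothesis lamI : injective lam.
Variable B : 'I_n -> bool * nat -> T -> T.
Hypothesis BL : forall k j, islin (B k j).
Hypothesis BE : forall k j v w, B k j (mu v w) = mu v (dfwith w (A j (w k))).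

Lemma mu_twist b (j : int) k v w M : (forall i, (M <= i)%N -> A (b, i) (w k) = 0) ->
  mu v (dfwith w (fsum (fun i => twist_coef (lam k) j i *: A (b, i) (w k)))) =
  \sum_(i < M) twist_coef (lam k) j i *: B k (b, i : nat) (mu v w).
Proof.
move=> wM; rewrite (fsum_widen (N := M)) => [|i Mi]; last by rewrite wM // scaler0.
rewrite (islin_sum (tensor_islin_factor muT _ _ (k := k))).
apply: eq_bigr => i _.
by rewrite (islinZ (tensor_islin_factor muT _ _ (k := k))) BE.
Qed.

Lemma A_fin_family (w : forall k, Wc k) :
  exists M, forall k b i, (M <= i)%N -> A (b, i) (w k) = 0.
Proof.
have [N NP] := boolp.choice (fun k => A_fin (w k)).
exists (\max_(k < n) N k) => k b i Mi; apply: NP.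
by apply: leq_trans Mi; apply: leq_bigmax.
Qed.

(** For a pure tensor the term in [V] dies in large degree. The truncation [M'] stays free so that
    bounds can be merged for sums of tensors and enlarged later. *)
Lemma large_degree_action b t : exists N M, forall (j M' : nat),
  (N <= j)%N -> (M <= M')%N ->
  LT b j t = \sum_(k < n) \sum_(i < M') twist_coef (lam k) j i *: B k (b, i : nat) t.
Proof.
move: t; apply: (tensor_span muT) => [|v w].
  split=> [|a x y [Nx [Mx xP]] [Ny [My yP]]].
    exists 0%N, 0%N => j M' _ _; rewrite (islin0 (LTL _ _)) big1 // => k _.
    by rewrite big1 // => i _; rewrite (islin0 (BL _ _)) scaler0.
  exists (maxn Nx Ny), (maxn Mx My) => j M'.
  rewrite !geq_max => /andP [Nxj Nyj] /andP [MxM MyM].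
  rewrite LTL (xP _ M') // (yP _ M') // scaler_sumr -big_split /=.
  apply: eq_bigr => k _; rewrite scaler_sumr -big_split /=.
  by apply: eq_bigr => i _; rewrite BL scalerDr !scalerA (mulrC a).
have [N NP] := LV_fin v; have [M MP] := A_fin_family w.
exists N, M => j M' Nj MM'; rewrite LTE NP //.
rewrite (islin0 (tensor_islin_left muT w)) add0r.
apply: eq_bigr => k _; apply: mu_twist => i M'i.
by apply: MP; apply: leq_trans M'i.
Qed.

Variable S : T -> Prop.
Hypothesis SS : subspace S.
Hypothesis SLT : forall b j t, S t -> S (LT b j t).

(* In large degree only the factors W_k[lam_k] are moved, each through the
   Taylor expansion at lam_k of the polynomial acting; a polynomial that is
   (X - lam_k)^i at lam_k and vanishes to high order at 0 and at the other
   lam_l singles out one basis element acting on one factor. *)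
Lemma factor_stable k j t : S t -> S (B k j t).
Proof.
case: j => b i St; have [N [M tP]] := large_degree_action b t.
(* The order exceeds [i], so that the coefficient at [i] is among those prescribed. *)
pose M' := maxn M i.+1.
have [p [pN pM]] := interpolating_polynomial N M' k i lam0 lamI.
suff -> : B k (b, i) t = \sum_(j < size p) p`_j *: LT b j t.
  by apply: (subspace_sum SS) => j _; apply/(subspaceZ SS)/SLT.
have -> : \sum_(j < size p) p`_j *: LT b j t =
    \sum_(l < n) \sum_(a < M') (p \Po ('X + (lam l)%:P))`_a *: B l (b, a : nat) t.
  transitivity (\sum_(j < size p) \sum_(l < n) \sum_(a < M')
      (p`_j * twist_coef (lam l) j a) *: B l (b, a : nat) t).
    (* Degrees below [N], where the expansion of the action may fail, carry zero coefficients of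
       [p]. *)
    apply: eq_bigr => j _; have [jN|Nj] := ltnP j N.
      rewrite pN // scale0r big1 // => l _.
      by rewrite big1 // => a _; rewrite mul0r scale0r.
    rewrite (tP j M') ?leq_maxl // scaler_sumr; apply: eq_bigr => l _.
    by rewrite scaler_sumr; apply: eq_bigr => a _; rewrite scalerA.
  rewrite exchange_big /=; apply: eq_bigr => l _.
  rewrite exchange_big /=; apply: eq_bigr => a _.
  by rewrite -scaler_suml coef_comp_XaddC.
have iM' : (i < M')%N by rewrite leq_maxr.
rewrite (bigD1 k) //= (bigD1 (Ordinal iM')) //= pM // !eqxx scale1r.
rewrite big1 ?addr0 => [|a ai]; last first.
  rewrite pM // eqxx /=; move: ai; rewrite -val_eqE /= => /negbTE ->.
  by rewrite scale0r.
rewrite big1 ?addr0 // => l lk; rewrite big1 // => a _.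
by rewrite pM // (negbTE lk) scale0r.
Qed.

(** The contributions of the [Wc] lie in [S] by [factor_stable] and can be subtracted, for every
    integer [j], negative ones included. *)
Lemma left_stable b j v w : S (mu v w) -> S (mu (LV b j v) w).
Proof.
move=> Svw; have [M MP] := A_fin_family w.
rewrite -(addrK (\sum_(k < n) mu v (dfwith w
  (fsum (fun i => twist_coef (lam k) j i *: A (b, i) (w k))))) (mu (LV b j v) w)).
rewrite -LTE; apply: (subspaceB SS); first exact: SLT.
apply: (subspace_sum SS) => k _; rewrite (mu_twist _ _ (MP k b)).
by apply: (subspace_sum SS) => i _; apply/(subspaceZ SS)/factor_stable.
Qed.

End TwistedAction.

(** * Modules over $\widetilde{\mathcal W}$ as countable operator families *)

Section WmodFamily.
Variables (C : numClosedFieldType) (W : Wmod C).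

(** Since $t^i\frac{d}{dt}=d_{i-1}$, the shift indexes both kinds of operators by the exponent of
    $t$, and both twists then have the same coefficients. *)
Definition wop (p : bool * nat) : wcar W -> wcar W :=
  if p.1 then wd (w := W) (p.2%:Z - 1) else wI (w := W) p.2%:Z.

Lemma wop_islin p : is_Wmod W -> islin (wop p).
Proof.
case=> dL IL _ _ _; case: p => [[] i]; rewrite /wop /=; last exact: IL.
by apply: dL; lia.
Qed.

Lemma wop_simple : simple_W W -> simple_family wop.
Proof.
case=> _ Wsimple S SS SA; apply: Wsimple; split=> //.
split=> [m w m1 Sw|m w m0 Sw].
  have := SA (true, absz (m + 1)) w Sw; rewrite /wop /= gez0_abs; last by lia.
  by rewrite addrK.
by have := SA (false, absz m) w Sw; rewrite /wop /= gez0_abs.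
Qed.

Lemma wop_locally_finite w : in_O_W W ->
  exists N, forall b i, (N <= i)%N -> wop (b, i) w = 0.
Proof.
(* The successor absorbs the shift from [i] to [i - 1]. *)
move=> /(_ w) [N NP]; exists (absz N).+1 => b i Ni.
by case: b; rewrite /wop /=; [apply: (NP _ _).1|apply: (NP _ _).2]; lia.
Qed.

Lemma tw_d_wop lam j w : tw_d lam W (j - 1) w =
  fsum (fun i => twist_coef lam j i *: wop (true, i) w).
Proof. by rewrite /tw_d subrK. Qed.

End WmodFamily.

(** * Simplicity of the tensor product over $\mathcal L$ *)

Unset Implicit Arguments.

Theorem theorem34 (R : realType) (n : nat)
  (V : lmodType R[i]) (d I : int -> V -> V) (z1 z2 z3 : V -> V)
  (W : 'I_n -> Wmod R[i]) (lam : 'I_n -> R[i])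
  (T : lmodType R[i]) (mu : V -> (forall k : 'I_n, wcar (W k)) -> T)
  (dT IT : int -> T -> T) (zT1 zT2 zT3 : T -> T) :
  (* V is a simple L-module in O_L *)
  is_Lmod d I z1 z2 z3 -> in_O_L d I -> simple_L d I z1 z2 z3 ->
  (* W_1, ..., W_n are simple nontrivial W~-modules in O_W~ *)
  (forall k : 'I_n, [/\ is_Wmod (W k), in_O_W (W k), simple_W (W k)
               & nontrivial_W (W k)]) ->
  (* lambda_1, ..., lambda_n are nonzero and pairwise distinct *)
  (forall k : 'I_n, lam k != 0) -> injective lam ->
  (* T = V (x) W_1 (x) ... (x) W_n with canonical multilinear map mu *)
  is_tensor_product V n (fun k : 'I_n => wcar (W k)) T mu ->
  (* the L-action on V (x) W_1[lambda_1] (x) ... (x) W_n[lambda_n] *)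
  (forall m, islin (dT m)) -> (forall m, islin (IT m)) ->
  islin zT1 -> islin zT2 -> islin zT3 ->
  (forall m v w, dT m (mu v w) =
     mu (d m v) w + \sum_(k < n) mu v (dfwith w (tw_d (lam k) (W k) m (w k)))) ->
  (forall m v w, IT m (mu v w) =
     mu (I m v) w + \sum_(k < n) mu v (dfwith w (tw_I (lam k) (W k) m (w k)))) ->
  (forall v w, zT1 (mu v w) = mu (z1 v) w) ->
  (forall v w, zT2 (mu v w) = mu (z2 v) w) ->
  (forall v w, zT3 (mu v w) = mu (z3 v) w) ->
  simple_L dT IT zT1 zT2 zT3.
Proof.
move=> _ VO [[v0 v00] Vsimple] Wall lam0 lamI muT dTL ITL _ _ _ dTE ITE z1E z2E z3E.
pose A k := @wop _ (W k).
have AL k j : islin (A k j) by apply: wop_islin; have [] := Wall k.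
have Asimple k : simple_family (A k) by apply: wop_simple; have [] := Wall k.
have A_fin k (w : wcar (W k)) : exists N, forall b i, (N <= i)%N -> A k (b, i) w = 0.
  by apply: wop_locally_finite; have [] := Wall k.
(* Indexed by the exponent of $t$, as for the operators on the [W k]. *)
pose LV (b : bool) (j : int) := if b then d (j - 1) else I j.
pose LT (b : bool) (j : int) := if b then dT (j - 1) else IT j.
have LV_fin v : exists N : nat, forall b (j : nat), (N <= j)%N -> LV b j v = 0.
  have [N NP] := VO v; exists (absz N).+1 => b j Nj.
  by case: b; rewrite /LV; [apply: (NP _ _).1|apply: (NP _ _).2]; lia.
have LTL b j : islin (LT b j) by case: b; [apply: dTL | apply: ITL].
have LTE b j v w : LT b j (mu v w) = mu (LV b j v) w + \sum_(k < n) mu v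
    (dfwith w (fsum (fun i => twist_coef (lam k) j i *: A k (b, i) (w k)))).
  case: b; rewrite /LT /LV; last exact: ITE.
  by rewrite dTE; congr (_ + _); apply: eq_bigr => k _; rewrite tw_d_wop.
have [B0 B0P] := boolp.choice (fun p : 'I_n * (bool * nat) =>
  tensor_factor_op muT (AL p.1 p.2)).
pose B k j := B0 (k, j).
have BL k j : islin (B k j) := (B0P (k, j)).1.
have BE k j v w : B k j (mu v w) = mu v (dfwith w (A k j (w k))) :=
  (B0P (k, j)).2 v w.
split.
  have wP k : exists w : wcar (W k), w != 0 by have [_ _ []] := Wall k.
  exists (mu v0 (fun k => projT1 (cid (wP k)))).
  by apply: (tensor_neq0 muT) => // k; case: cid.
move=> S [SS [Sd SI Sz1 Sz2 Sz3]] Sn0.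
have SLT b j t : S t -> S (LT b j t) by case: b; [apply: Sd | apply: SI].
have SLV := left_stable muT A_fin LV_fin LTL LTE lam0 lamI BL BE SS SLT.
apply: (stable_subspace_full muT (@complex_uncountable R) AL Asimple BL BE SS) => //.
  exact: (factor_stable muT A_fin LV_fin LTL LTE lam0 lamI BL BE SS SLT).
(* For fixed [w], the [v] with [mu v w] in [S] form a submodule of [V]: [left_stable] handles [d]
   and [I], and the central elements act through [V] alone. *)
move=> w; apply: Vsimple; split.
  split=> [|a x y Sx Sy].
    by rewrite (islin0 (tensor_islin_left muT w)); apply: subspace0 SS.
  by rewrite (tensor_islin_left muT w); case: SS => _; apply.
split=> [m v /(SLV true (m + 1))|m v /(SLV false m)|v|v|v] //.
- by rewrite /LV addrK.
- by rewrite -z1E; apply: Sz1.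
- by rewrite -z2E; apply: Sz2.
- by rewrite -z3E; apply: Sz3.
Qed.
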